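(* Let $\mathbb{H}$ be a separable Hilbert space with scalar product $\langle\cdot,\cdot\rangle$, let $n\ge 1$ be an integer and $\sigma>0$, and let $Y(t)=\langle s,t\rangle+\frac{\sigma}{\sqrt n}L(t)$, $t\in\mathbb{H}$, where $L$ is a centered Gaussian isonormal process on $\mathbb{H}$. Let $T$ be a linear functional defined on $\mathcal{S}\subset\mathbb{H}$, let $\mathcal{M}\subset\mathbb{N}$, and let $(S_m,m\in\mathcal{M})$ be a finite or countable collection of finite dimensional linear subspaces of $\mathbb{H}$. Let $(x_m)_{m\in\mathcal{M}}$ and $(x_{j,m})_{(j,m)\in\mathcal{M}^2}$ be families of nonnegative real numbers, and let $\hat m$, $\hat s_{\hat m}$, $s_m$, $\sigma_m$, $\sigma_{j,m}$, $\mathrm{pen}(m)$, $H(j,m)$ be defined from these as described in the context. For $m\in\mathcal{M}$ set $$\mathrm{Crit}(m)=\sup_{j\ge m,\,j\in\mathcal{M}}|T(s_j)-T(s_m)|+\mathrm{pen}(m),$$ and let $$m^*=\inf\Big\{m\in\mathcal{M}:\ \mathrm{Crit}(m)\le\inf_{l\in\mathcal{M}}\mathrm{Crit}(l)+\frac1n\Big\}.$$ Then for every $p\ge 1$ there exists a positive constant $C(p)$ depending only on $p$ such that $$\mathbb{E}\big(|T(\hat s_{\hat m})-T(s)|^p\big)\le C(p)\Big((\mathrm{Crit}(m^* ))^p+|T(s_{m^*})-T(s)|^p+\sigma_{m^*}^p\Big)$$ $$+\,C(p)\Big(\sup_{j\le m^*,\,j\in\mathcal{M}}H^p(m^*,j)+\sum_{m\in\mathcal{M}}e^{-x_m}\sigma_m^p+\sum_{j\ge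 m^*,\,j\in\mathcal{M}}e^{-x_{j,m^*}}\sigma_{j,m^*}^p+\frac1{n^p}\Big).$$
   Context: A centered Gaussian isonormal process $L$ on $\mathbb{H}$ is a linear isometry from $\mathbb{H}$ onto a Gaussian subspace of $\mathbb{L}_2(\Omega)$, where $(\Omega,\mathcal{G},P)$ is a probability space; in particular $L(t)$ is centered Gaussian and $\mathrm{Cov}(L(t),L(u))=\langle t,u\rangle$ for all $t,u\in\mathbb{H}$. The element $s\in\mathbb{H}$ is unknown. The set $\mathcal{S}$ is a linear subspace of $\mathbb{H}$ containing $s$ and all the $S_m$, so that $T$ is defined on all of them. $\mathcal{M}$ is nonempty and ordered as a subset of $\mathbb{N}$; the $S_m$ are not assumed to be nested. For $m\in\mathcal{M}$, let $(\phi_\lambda,\lambda\in\Lambda_m)$ be an orthonormal basis of $S_m$, let $s_m$ be the orthogonal projection of $s$ onto $S_m$, and let $$\hat s_m=\sum_{\lambda\in\Lambda_m}Y(\phi_\lambda)\phi_\lambda,\qquad \sigma_m^2=\frac{\sigma^2}{n}\sum_{\lambda\in\Lambda_m}T^2(\phi_\lambda)\ (\sigma_m\ge0),\qquad \mathrm{pen}(m)=\sqrt{2x_m}\,\sigma_m .$$ For $j,m\in\mathcal{M}$, $$\sigma_{j,m}^2=\frac{\sigma^2}{n}\mathbb{E}\Big[\Big(\sum_{\lambda\in\Lambda_m}T(\phi_\lambda)L(\phi_\lambda)-\sum_{\lambda\in\Lambda_j}T(\phi_\lambda)L(\phi_\lambda)\Big)^2\Big]\ (\sigma_{j,m}\ge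 0),\qquad H(j,m)=\sqrt{2x_{j,m}}\,\sigma_{j,m}.$$ For $m\in\mathcal{M}$, $$\widehat{\mathrm{Crit}}(m)=\sup_{j\ge m,\,j\in\mathcal{M}}\big[|T(\hat s_m)-T(\hat s_j)|-H(j,m)\big]+\mathrm{pen}(m),$$ and $$\hat m=\inf\Big\{m\in\mathcal{M}:\ \widehat{\mathrm{Crit}}(m)\le\inf_{j\in\mathcal{M}}\widehat{\mathrm{Crit}}(j)+\frac1n\Big\}.$$ Suprema, infima and series take values in $[0,+\infty]$; the inequality is trivially true when its right-hand side is $+\infty$. *)

(* Defs.v *)
(* MathComp-Analysis; R : realType plays the role of the real numbers. *)
From mathcomp Require Export all_boot all_order all_algebra.
From mathcomp Require Export all_classical all_reals all_analysis.
From mathcomp Require Export sesquilinear.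
Export Order.TTheory GRing.Theory Num.Theory.
Export numFieldNormedType.Exports.

Set Implicit Arguments.
Unset Strict Implicit.
Unset Printing Implicit Defensive.

Local Open Scope classical_set_scope.
Local Open Scope ring_scope.

(* The library has no inner product spaces: a Hilbert space is a complete
   normed module H whose norm is the one of a symmetric bilinear positive
   definite form. *)
Definition hilbert_norm (R : realType) (H : completeNormedModType R)
    (dot : {dot H for idfun}) : Prop :=
  forall u : H, `|u| ^+ 2 = dot u u.

Definition separable (T : topologicalType) : Prop :=
  exists2 D : set T, countable D & dense D.

Definition linear_subspace (R : realType) (V : lmodType R) (A : set V) : Prop :=
  submod_closed (mem A).

(* T is a total function, but only its values on the subspace A are
   constrained; they are also the only ones ever used. *)
Definition linear_functional_on (R : realType) (V : lmodType R)
    (A : set V) (T : V -> R) : Prop :=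
  forall a u v, A u -> A v -> T (a *: u + v) = a * T u + T v.

Record orthonormal_basis (R : realType) (V : lmodType R)
    (dot : {dot V for idfun}) (A : set V) (I : finType) (e : I -> V) : Prop := {
  basis_mem : forall i, A (e i) ;
  basis_orthonormal : forall i j, dot (e i) (e j) = (i == j)%:R ;
  basis_span : forall v, A v -> exists c : I -> R, v = \sum_i c i *: e i }.

(* The element of A whose difference with v is orthogonal to A; the default
   value 0 is never used when A is a finite dimensional subspace. *)
Definition orth_proj (R : realType) (V : lmodType R)
    (dot : {dot V for idfun}) (A : set V) (v : V) : V :=
  xget 0 [set w | A w /\ forall u, A u -> dot (v - w) u = 0].

(* [normal_prob m 0] is the uniform law on `[0, 1], so the degenerate Gaussian
   law (the Dirac mass at m) is treated apart. *)
Definition gaussian_law (R : realType) (m sd : R) (B : set R) : \bar R :=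
  if sd == 0 then \d_m B else normal_prob m sd B.

Definition centered_gaussian (d : measure_display) (Omega : measurableType d)
    (R : realType) (P : probability Omega R) (X : {RV P >-> R}) : Prop :=
  exists2 sd : R, 0 <= sd &
    forall B, measurable B -> distribution P X B = gaussian_law 0 sd B.

(* A linear isometry from H onto a Gaussian subspace of L^2(Omega): elements of
   L^2 are represented by random variables, hence linearity holds almost
   surely.  Polarization gives Cov(L t, L u) = dot t u, and linearity makes the
   process jointly Gaussian. *)
Record isonormal_process (d : measure_display) (Omega : measurableType d)
    (R : realType) (P : probability Omega R) (H : completeNormedModType R)
    (L : H -> {RV P >-> R}) : Prop := {
  isonormal_linear : forall (a : R) (t u : H),
    {ae P, forall w, L (a *: t + u) w = a * L t w + L u w} ;
  isonormal_isometry : forall t, ('N[P]_2%:E[EFin \o L t] = (`|t|%R)%:E)%E ;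
  isonormal_gaussian : forall t, centered_gaussian (L t) }.

Section Criteria.
Context (R : realType).

Definition observation (H : completeNormedModType R) (dot : {dot H for idfun})
    (s : H) (n : nat) (sigma : R) (Omega : Type) (L : H -> Omega -> R)
    (t : H) (w : Omega) : R :=
  dot s t + sigma / Num.sqrt n%:R * L t w.

Definition projection_estimator (H : completeNormedModType R) (Omega : Type)
    (Y : H -> Omega -> R) (I : finType) (e : I -> H) (w : Omega) : H :=
  \sum_i Y (e i) w *: e i.

Definition sigma1 (H : completeNormedModType R) (n : nat) (sigma : R)
    (T : H -> R) (I : finType) (e : I -> H) : R :=
  Num.sqrt (sigma ^+ 2 / n%:R * \sum_i T (e i) ^+ 2).

(* The expectation is finite, hence [fine] loses nothing. *)
Definition sigma2 (d : measure_display) (Omega : measurableType d)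
    (P : probability Omega R) (H : completeNormedModType R) (n : nat)
    (sigma : R) (T : H -> R) (L : H -> {RV P >-> R})
    (J : finType) (ej : J -> H) (I : finType) (em : I -> H) : R :=
  Num.sqrt (sigma ^+ 2 / n%:R *
    fine 'E_P[fun w => (\sum_i T (em i) * L (em i) w
                        - \sum_i T (ej i) * L (ej i) w) ^+ 2]).

(* Crit(m) = sup_{j >= m, j in M} D(j, m) + pen(m), in the extended reals;
   used with D(j, m) = |T(s_j) - T(s_m)| and with
   D(j, m) = |T(shat_m) - T(shat_j)| - H(j, m). *)
Definition criterion (M : set nat) (D : nat -> nat -> R) (pen : nat -> R)
    (m : nat) : \bar R :=
  (ereal_sup [set (D j m)%:E | j in [set j | M j /\ (m <= j)%N]]
   + (pen m)%:E)%E.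

(* The infimum is taken in nat: it is the least element of the set, which is
   nonempty as soon as M is nonempty and crit is nonnegative on M. *)
Definition selected (M : set nat) (crit : nat -> \bar R) (n : nat) : nat :=
  infimum 0%N [set m | M m /\
    (crit m <= ereal_inf [set crit j | j in M] + (n%:R^-1)%:E)%E].

End Criteria.

(* Main.v *)
(* Write X m = T (shat m) - T (s_m): it is almost surely L (tau m) for a vector
   tau m of norm sigma_m, and sigma_{j,m} is the norm of tau m - tau j.  A
   Gaussian variable Z of standard deviation v satisfies
   E (|Z| - sqrt (2 x) v)_+^p <= C e^(-x) v^p, which yields the two series after
   bounding suprema of p-th powers by sums.  Deterministically, writing m' for
   the oracle index and b = sup_j (|X j - X m'| - H(j, m'))_+, the selection
   rule gives Crithat(mhat) <= Crit(m') + b + 1/n.  If mhat >= m', compare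
   T (shat mhat) to T (s_mhat) using pen(mhat) <= Crithat(mhat), and T (s_mhat)
   to T (s_m') using Crit(m'); if mhat <= m', compare T (shat mhat) directly to
   T (shat m') using Crithat(mhat) + H(m', mhat). *)
Require Import Defs.
From mathcomp Require Import measurable_realfun ring lra.

Set Implicit Arguments.
Unset Strict Implicit.
Unset Printing Implicit Defensive.

Local Open Scope classical_set_scope.
Local Open Scope ring_scope.

(** * Integration against a measure given by a density *)

Section density.
Local Open Scope ereal_scope.
Context d (T : measurableType d) (R : realType).
Variables (mu nu : {measure set T -> \bar R}) (g : T -> R).
Hypotheses (mg : measurable_fun setT g) (g0 : forall x, (0 <= g x)%R).
Hypothesis nuE : forall A, measurable A -> nu A = \int[mu]_(x in A) (g x)%:E.

Import HBNNSimple.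

(** For an indicator this is [nuE]. Linearity extends it to the nonnegative simple functions [h n],
    and monotone convergence, applied on both sides to the increasing sequence [h n], extends it to
    [f]. *)
Lemma ge0_integral_density (f : T -> \bar R) :
  measurable_fun setT f -> (forall x, 0 <= f x) ->
  \int[nu]_x f x = \int[mu]_x (f x * (g x)%:E).
Proof.
move=> mf f0; pose h := nnsfun_approx measurableT mf.
have mgE : measurable_fun setT (EFin \o g) by exact/measurable_EFinP.
have mh n : measurable_fun setT (EFin \o h n).
  by apply/measurable_EFinP; exact/measurable_funP.
have hf x : (h n x)%:E @[n --> \oo] --> f x by exact: cvg_nnsfun_approx.
have ndh x m n : (m <= n)%N -> (h m x <= h n x)%R.
  by move=> mn; exact/lefP/nd_nnsfun_approx.
have hE n : \int[nu]_x (h n x)%:E = \int[mu]_x ((h n x)%:E * (g x)%:E).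
  under eq_integral do rewrite fimfunE -fsumEFin//.
  under [RHS]eq_integral => x _.
    rewrite fimfunE -fsumEFin// ge0_mule_fsuml; last first.
      by move=> r; exact: nnfun_muleindic_ge0.
    over.
  have mindic r : measurable_fun setT
      (fun x => (r * \1_(h n @^-1` [set r]) x)%:E).
    by apply/measurable_EFinP; exact: measurable_funM.
  rewrite !ge0_integral_fsum//; last 3 first.
  - by move=> r; exact: emeasurable_funM.
  - move=> r x _; rewrite mule_ge0 ?lee_fin//.
    exact: nnfun_muleindic_ge0.
  - by move=> r x _; exact: nnfun_muleindic_ge0.
  (* Only values attained by [h n] are summed, so [r] is some [h n y] and is nonnegative. *)
  apply: eq_fsbigr => r /[!inE] -[y _ <-].
  rewrite integralZl_indic_nnsfun// integral_indic// setIT nuE//.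
  under [RHS]eq_integral do rewrite EFinM -muleA.
  rewrite [RHS]ge0_integralZl//; last 3 first.
  - apply: emeasurable_funM => //.
    by apply/measurable_EFinP; exact: measurable_indic.
  - by move=> x _; rewrite mule_ge0 ?lee_fin.
  - by rewrite lee_fin.
  congr (_ * _); rewrite integral_mkcond; apply: eq_integral => x _.
  by rewrite epatch_indic muleC.
transitivity (limn (fun n => \int[nu]_x (h n x)%:E)).
  rewrite -monotone_convergence//.
  - by apply: eq_integral => x _; apply/esym/cvg_lim => //; exact: hf.
  - by move=> n x _; rewrite lee_fin.
  - by move=> x _ m n mn; rewrite lee_fin ndh.
rewrite (eq_fun hE) -monotone_convergence//.
- apply: eq_integral => x _; apply/cvg_lim => //.
  by apply: cvgeZr => //; exact: hf.
- by move=> n; exact: (emeasurable_funM (mh n) mgE).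
- by move=> n x _; rewrite mule_ge0 ?lee_fin.
- by move=> x _ m n mn; rewrite lee_wpmul2r ?lee_fin// ndh.
Qed.

End density.

(** * Tail moments and second moment of a centered normal law *)

Section gaussian_moments.
Context {R : realType}.
Implicit Types (p t v x z : R).

Lemma measurable_excess (p c : R) :
  measurable_fun setT (fun z : R => (Num.max 0 (`|z| - c)) `^ p).
Proof.
apply: (measurableT_comp (measurable_powR p)).
by apply: measurable_maxr => //; apply: measurable_funB.
Qed.

(** Since [ln t <= t], the exponent [p * ln t] is at most [p * t], and [(p - t / 2) ^+ 2 >= 0]
    bounds the latter. The quadratic term is small enough to be absorbed by half of a Gaussian
    exponent. *)
Lemma powR_le_expR p t : 0 < p -> 0 <= t ->
  t `^ p <= expR (p ^+ 2 + t ^+ 2 / 4).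
Proof.
move=> p0; rewrite le_eqVlt => /predU1P[<-|t0].
  by rewrite powR0 ?gt_eqF// expR_ge0.
rewrite /powR gt_eqF// ler_expR.
have := ln_sublinear t0.
have := sqr_ge0 (p - t / 2).
nra.
Qed.

(** The factor 2 counts the two widened densities centered at [a * v] and [- (a * v)], [Num.sqrt 2]
    is the ratio of the peaks before and after widening, and [expR (p ^+ 2)] comes from
    [powR_le_expR]. *)
Definition gauss_cst p : R := 2 * (Num.sqrt 2 * expR (p ^+ 2)).

Lemma gauss_cst_gt0 p : 0 < gauss_cst p.
Proof. by rewrite !mulr_gt0 ?expR_gt0 ?sqrtr_gt0. Qed.

Lemma normal_peakZ (a : R) v : 0 <= a ->
  normal_peak (a * v) = a^-1 * normal_peak v.
Proof.
move=> a0; rewrite /normal_peak exprMn -mulrA -mulrnAr sqrtrM ?sqr_ge0//.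
by rewrite sqrtr_sqr ger0_norm// invfM.
Qed.

(* Completing the square gives the factor [exp (- a ^ 2 / 2)]; widening the
   density by [sqrt 2] absorbs the power [p]. *)
Lemma excess_normal_pdf p v (a : R) z : 0 < p -> 0 < v -> 0 <= a ->
  (Num.max 0 (`|z| - a * v)) `^ p * normal_pdf 0 v z <=
  Num.sqrt 2 * expR (p ^+ 2) * v `^ p * expR (- (a ^+ 2 / 2)) *
  (normal_pdf (a * v) (Num.sqrt 2 * v) z
   + normal_pdf (- (a * v)) (Num.sqrt 2 * v) z).
Proof.
move=> p0 v0 a0.
have s2 : 0 < Num.sqrt 2 :> R by rewrite sqrtr_gt0.
have C0 : 0 <= Num.sqrt 2 * expR (p ^+ 2) * v `^ p * expR (- (a ^+ 2 / 2)).
  by rewrite !mulr_ge0 ?expR_ge0 ?powR_ge0// ltW.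
have [zav|avz] := leP (`|z| - a * v) 0.
  by rewrite powR0 ?gt_eqF// mul0r mulr_ge0// addr_ge0// normal_pdf_ge0.
(* The excess over the threshold, measured in standard deviations. *)
set u := (`|z| - a * v) / v.
have u0 : 0 <= u by rewrite divr_ge0// ltW.
have zE : `|z| = (u + a) * v by rewrite /u; field; rewrite gt_eqF.
have pdfE : normal_pdf 0 v z = normal_peak v * expR (- ((u + a) ^+ 2 / 2)).
  rewrite normal_pdfE ?gt_eqF// /normal_fun subr0; congr (_ * expR _).
  have -> : z ^+ 2 = ((u + a) * v) ^+ 2 by rewrite -zE real_normK ?num_real.
  by field; rewrite gt_eqF.
(* The density centered on the same side as [z] takes exactly this value; the other one is only
   nonnegative. *)
have wide : normal_peak (Num.sqrt 2 * v) * expR (- (u ^+ 2 / 4)) <=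
   normal_pdf (a * v) (Num.sqrt 2 * v) z
   + normal_pdf (- (a * v)) (Num.sqrt 2 * v) z.
  have vN0 : v != 0 by rewrite gt_eqF.
  have E (y : R) : (y - a * v = u * v) \/ (y - a * v = - (u * v)) ->
    expR (- (y - a * v) ^+ 2 / ((Num.sqrt 2 * v) ^+ 2 *+ 2)) =
    expR (- (u ^+ 2 / 4)).
    move=> H; congr expR.
    have -> : (y - a * v) ^+ 2 = (u * v) ^+ 2.
      by case: H => -> //; rewrite sqrrN.
    by rewrite !exprMn sqr_sqrtr//; field.
  have [zp|zn] := ger0P z.
  - apply: ler_wpDr; first exact: normal_pdf_ge0.
    rewrite normal_pdfE ?gt_eqF ?mulr_gt0// /normal_fun E//.
    by left; rewrite -{1}(ger0_norm zp) zE; ring.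
  - apply: ler_wpDl; first exact: normal_pdf_ge0.
    rewrite normal_pdfE ?gt_eqF ?mulr_gt0// /normal_fun opprK.
    have -> : (z + a * v) ^+ 2 = (- z - a * v) ^+ 2 by ring.
    by rewrite E//; left; rewrite -(ltr0_norm zn) zE; ring.
apply: le_trans (ler_wpM2l C0 wide).
rewrite normal_peakZ ?(ltW s2)// pdfE.
have -> : `|z| - a * v = u * v by rewrite zE; ring.
rewrite powRM ?(ltW v0)//.
have -> : Num.sqrt 2 * expR (p ^+ 2) * v `^ p * expR (- (a ^+ 2 / 2)) *
    ((Num.sqrt 2)^-1 * normal_peak v * expR (- (u ^+ 2 / 4))) =
    expR (p ^+ 2) * expR (- (a ^+ 2 / 2)) * expR (- (u ^+ 2 / 4)) *
    (v `^ p * normal_peak v).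
  by field; rewrite gt_eqF.
have -> : u `^ p * v `^ p * (normal_peak v * expR (- ((u + a) ^+ 2 / 2))) =
    u `^ p * expR (- ((u + a) ^+ 2 / 2)) * (v `^ p * normal_peak v) by ring.
rewrite ler_wpM2r ?mulr_ge0 ?powR_ge0 ?normal_peak_ge0//.
apply: (@le_trans _ _ (expR (p ^+ 2 + u ^+ 2 / 4) *
    expR (- ((u + a) ^+ 2 / 2)))).
  by rewrite ler_wpM2r ?expR_ge0// powR_le_expR.
rewrite -!expRD ler_expR.
(* The exponent on the left is [p ^+ 2 - a ^+ 2 / 2 - u ^+ 2 / 4 - u * a]; the comparison drops the
   cross term. *)
have := mulr_ge0 u0 a0.
nra.
Qed.

(** The pointwise bound [excess_normal_pdf] is integrated, each of the two widened densities having
    total mass one. With [a = Num.sqrt (2 * x)] the last factor becomes [expR (- x)]. *)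
Lemma integral_excess_normal p v (a : R) : 0 < p -> 0 < v -> 0 <= a ->
  (\int[normal_prob 0%R v]_z ((Num.max 0 (`|z| - a * v)) `^ p)%:E
   <= (gauss_cst p * v `^ p * expR (- (a ^+ 2 / 2)))%:E)%E.
Proof.
move=> p0 v0 a0.
have mexc := measurable_excess p (a * v).
rewrite (ge0_integral_density (mu := lebesgue_measure) (g := normal_pdf 0 v))//;
  [|exact: measurable_normal_pdf|exact: normal_pdf_ge0|exact/measurable_EFinP
   |by move=> z; rewrite lee_fin powR_ge0].
set C := Num.sqrt 2 * expR (p ^+ 2) * v `^ p * expR (- (a ^+ 2 / 2)).
have C0 : 0 <= C by rewrite !mulr_ge0 ?expR_ge0 ?powR_ge0.
apply: (@le_trans _ _ (\int[lebesgue_measure]_z (C%:E *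
   ((normal_pdf (a * v) (Num.sqrt 2 * v) z)%:E
   + (normal_pdf (- (a * v)) (Num.sqrt 2 * v) z)%:E)))%E).
  have mpdf m s : measurable_fun setT (fun z : R => (normal_pdf m s z)%:E).
    by apply/measurable_EFinP; exact: measurable_normal_pdf.
  apply: ge0_le_integral => //=.
  - by move=> z _; rewrite -EFinM lee_fin mulr_ge0 ?powR_ge0 ?normal_pdf_ge0.
  - by apply: (emeasurable_funM _ (mpdf 0 v)); exact/measurable_EFinP.
  - have := emeasurable_funD (mpdf (a * v) (Num.sqrt 2 * v))
      (mpdf (- (a * v)) (Num.sqrt 2 * v)).
    by apply: emeasurable_funM; exact: measurable_cst.
  - by move=> z _; rewrite -EFinM -EFinD -EFinM lee_fin excess_normal_pdf.
rewrite integralZl//; last first.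
  by apply: integrableD => //; exact: integrable_normal_pdf.
rewrite integralD//; [|exact: integrable_normal_pdf..].
rewrite !integral_normal_pdf -EFinD -EFinM lee_fin /gauss_cst /C.
lra.
Qed.

(* Shrinking the standard deviation by the factor [q]: the pointwise bound is
   [1 <= y + expR (- y)], and integrating it gives the second moment. *)
Lemma normal_pdf_shrink v (q : R) z : 0 < v -> 0 < q ->
  normal_pdf 0 v z <=
  (1 - q ^+ 2) / (2 * q ^+ 2 * v ^+ 2) * (z ^+ 2 * normal_pdf 0 v z)
  + q * normal_pdf 0 (q * v) z.
Proof.
move=> v0 q0; set y := (1 - q ^+ 2) / (2 * q ^+ 2 * v ^+ 2) * z ^+ 2.
have qE : q * normal_pdf 0 (q * v) z = normal_pdf 0 v z * expR (- y).
  rewrite !normal_pdfE ?gt_eqF ?mulr_gt0// normal_peakZ ?(ltW q0)//.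
  rewrite -[RHS]mulrA /normal_fun -expRD mulrA mulVKf ?gt_eqF//.
  congr (_ * expR _); rewrite /y subr0.
  by field; rewrite ?gt_eqF.
rewrite qE mulrA -/y mulrC -mulrDr ler_peMr ?normal_pdf_ge0//.
have := expR_ge1Dx (- y); lra.
Qed.

(** Let [m] be the second moment. Integrating [normal_pdf_shrink] gives
    [2 * q ^+ 2 * v ^+ 2 <= (1 + q) * m] for every [q] in []0, 1[], and [q] close to 1 gives the
    claim. This bounds the standard deviation of [L t] by the norm of [t]. *)
Lemma normal_second_moment_ge v : 0 < v ->
  ((v ^+ 2)%:E <= \int[normal_prob 0%R v]_z (z ^+ 2)%:E)%E.
Proof.
move=> v0.
have msq : measurable_fun setT (fun z : R => (z ^+ 2)%:E).
  by apply/measurable_EFinP; exact: measurable_funX.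
have mpdf s : measurable_fun setT (fun z : R => (normal_pdf 0 s z)%:E).
  by apply/measurable_EFinP; exact: measurable_normal_pdf.
rewrite (ge0_integral_density (mu := lebesgue_measure) (g := normal_pdf 0 v))//;
  [|exact: measurable_normal_pdf|exact: normal_pdf_ge0
   |by move=> z; rewrite lee_fin sqr_ge0].
have m2_ge0 : (0 <=
    \int[lebesgue_measure]_z ((z ^+ 2)%:E * (normal_pdf 0 v z)%:E))%E.
  apply: integral_ge0 => z _.
  by rewrite -EFinM lee_fin mulr_ge0 ?sqr_ge0 ?normal_pdf_ge0.
have shrink (q : R) : 0 < q -> q < 1 ->
    (1 <= ((1 - q ^+ 2) / (2 * q ^+ 2 * v ^+ 2))%:E *
       \int[lebesgue_measure]_z ((z ^+ 2)%:E * (normal_pdf 0 v z)%:E)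
     + q%:E)%E.
  move=> q0 q1.
  have c0 : 0 <= (1 - q ^+ 2) / (2 * q ^+ 2 * v ^+ 2).
    by rewrite divr_ge0 ?subr_ge0 ?expr_le1 ?ltW// !mulr_gt0 ?exprn_gt0.
  have mM : measurable_fun setT
      (fun z : R => (z ^+ 2)%:E * (normal_pdf 0 v z)%:E)%E.
    exact: emeasurable_funM msq (mpdf v).
  rewrite -(integral_normal_pdf 0 v) -[X in (_ + X)%E]mule1.
  rewrite -(integral_normal_pdf 0 (q * v)).
  have M0 z : (0 <= (z ^+ 2)%:E * (normal_pdf 0 v z)%:E)%E.
    by rewrite -EFinM lee_fin mulr_ge0 ?sqr_ge0 ?normal_pdf_ge0.
  have P0 s z : (0 <= (normal_pdf 0 s z)%:E)%E.
    by rewrite lee_fin normal_pdf_ge0.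
  have mcM : measurable_fun setT (fun z : R =>
      ((1 - q ^+ 2) / (2 * q ^+ 2 * v ^+ 2))%:E *
      ((z ^+ 2)%:E * (normal_pdf 0 v z)%:E))%E.
    exact: emeasurable_funM (measurable_cst _) mM.
  have mqp : measurable_fun setT
      (fun z : R => q%:E * (normal_pdf 0 (q * v) z)%:E)%E.
    exact: emeasurable_funM (measurable_cst _) (mpdf _).
  rewrite -ge0_integralZl//.
  rewrite -ge0_integralZl//; [|exact: mpdf|exact: ltW].
  rewrite -ge0_integralD//; last 2 first.
  - by move=> z _; apply: mule_ge0; [exact: c0|exact: M0].
  - by move=> z _; apply: mule_ge0; [exact: ltW|exact: P0].
  apply: ge0_le_integral => //.
  - exact: mpdf.
  - exact: emeasurable_funD mcM mqp.
  - move=> z _; rewrite -!EFinM -EFinD lee_fin.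
    exact: normal_pdf_shrink.
move: m2_ge0 shrink.
move: (\int[lebesgue_measure]_z _)%E => [m| |]//; first last.
  by move=> _ _; rewrite leey.
rewrite !lee_fin => m0 shrink; rewrite leNgt; apply/negP => mv.
(* An explicit [q = 1 - e] replaces the limit: it yields [(1 - 2 * e) * v ^+ 2 <= m], whereas
   [2 * e * v ^+ 2] is only half of the gap [v ^+ 2 - m]. *)
pose e := (v ^+ 2 - m) / (4 * v ^+ 2).
have v20 : 0 < v ^+ 2 by rewrite exprn_gt0.
have e0 : 0 < e by rewrite divr_gt0 ?subr_gt0 ?mulr_gt0.
have eE : e * (4 * v ^+ 2) = v ^+ 2 - m by rewrite /e divfK// gt_eqF ?mulr_gt0.
have e1 : e <= 1 / 4 by nra.
set q := 1 - e.
have q0 : 0 < q by rewrite /q; lra.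
have q1 : q < 1 by rewrite /q; lra.
have := shrink _ q0 q1; rewrite -EFinM -EFinD lee_fin.
have q20 : 0 < 2 * q ^+ 2 * v ^+ 2 by rewrite !mulr_gt0 ?exprn_gt0.
rewrite mulrAC -lerBlDr ler_pdivlMr// => H.
have : 2 * q ^+ 2 * v ^+ 2 <= (1 + q) * m.
  rewrite -(ler_pM2l e0).
  have -> : e = 1 - q by rewrite /q; lra.
  nra.
move=> {}H.
have : q ^+ 2 * v ^+ 2 <= m by nra.
have : (1 - 2 * e) * v ^+ 2 <= q ^+ 2 * v ^+ 2.
  by rewrite ler_wpM2r ?(ltW v20)// /q; nra.
nra.
Qed.

End gaussian_moments.

(** * Moments and almost sure linearity of the isonormal process *)

Section isonormal.
Context (d : measure_display) (Omega : measurableType d) (R : realType)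
  (P : probability Omega R) (H : completeNormedModType R)
  (L : H -> {RV P >-> R}).
Hypothesis hL : isonormal_process L.
Implicit Types (p : R) (t u : H).

Lemma isonormal_sqr t :
  (\int[P]_w (L t w ^+ 2)%:E = (`|t| ^+ 2)%:E)%E.
Proof.
have := isonormal_isometry hL t => /(congr1 (fun y => (y `^ 2)%E)).
rewrite poweR_Lnorm// poweR_EFin powR_mulrn// => <-.
apply: eq_integral => w _.
by rewrite /= powR_mulrn// real_normK ?num_real.
Qed.

(* The canonical measurable structure on [R] and [measurableTypeR R], which
   carries the Lebesgue measure, have the same measurable sets but different
   displays. *)
Lemma integral_isonormal t (nu : {measure set (measurableTypeR R) -> \bar R})
    (f : measurableTypeR R -> R) :
  (forall A, measurable A -> distribution P (L t) A = nu A) ->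
  measurable_fun setT f -> (forall z, 0 <= f z) ->
  (\int[P]_w (f (L t w))%:E = \int[nu]_z (f z)%:E)%E.
Proof.
move=> nuE mf f0.
have mL : measurable_fun setT (L t : Omega -> measurableTypeR R).
  exact: (@measurable_funPT _ _ _ _ (L t)).
have := @ge0_integral_pushforward _ _ _ _ R _ mL P setT (EFin \o f) measurableT.
move=> <-; last 2 first.
- exact/measurable_EFinP.
- by move=> z _; rewrite lee_fin.
by apply: eq_measure_integral => A mA _; exact: nuE.
Qed.

(** The normal bound holds with the standard deviation [sd] of the law of [L t]. Replacing [sd] by
    the norm of [t] raises both the threshold and the bound, so [sd <= |t|] suffices. *)
Lemma isonormal_excess p t (y : R) : 0 < p -> 0 <= y ->
  (\int[P]_w ((Num.max 0 (`|L t w| - Num.sqrt (2 * y) * `|t|)) `^ p)%:E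
   <= (gauss_cst p * (expR (- y) * `|t| `^ p))%:E)%E.
Proof.
move=> p0 y0; have [sd sd0 lawE] := isonormal_gaussian hL t.
have y2 : 0 <= Num.sqrt (2 * y) by rewrite sqrtr_ge0.
have mexc (c : R) : measurable_fun setT
    (fun z : measurableTypeR R => (Num.max 0 (`|z| - c)) `^ p).
  exact: measurable_excess.
have exc0 (c z : R) : 0 <= (Num.max 0 (`|z| - c)) `^ p by exact: powR_ge0.
have C0 : 0 <= gauss_cst p * (expR (- y) * `|t| `^ p).
  by rewrite !mulr_ge0 ?expR_ge0 ?powR_ge0 ?(ltW (gauss_cst_gt0 p)).
(* If [sd = 0] the law is the Dirac mass at 0, whose excess over a nonnegative threshold
   vanishes. *)
move: sd0; rewrite le_eqVlt => /predU1P[sd0|sd0].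
  have lawD A : measurable A ->
      distribution P (L t) A = dirac (0 : measurableTypeR R) A.
    by move=> mA; rewrite lawE// /gaussian_law -sd0 eqxx.
  rewrite (integral_isonormal lawD (mexc _) (exc0 _)).
  rewrite integral_dirac//; last exact/measurable_EFinP.
  rewrite diracT mul1e normr0 add0r.
  have /max_idPl -> : - (Num.sqrt (2 * y) * `|t|) <= 0.
    by rewrite oppr_le0 mulr_ge0.
  by rewrite powR0 ?gt_eqF.
have lawN A : measurable A -> distribution P (L t) A = normal_prob 0 sd A.
  by move=> mA; rewrite lawE// /gaussian_law gt_eqF.
have sdt : sd <= `|t|.
  rewrite -(@ler_pXn2r _ 2) ?nnegrE ?(ltW sd0)// -lee_fin -isonormal_sqr.
  have msq : measurable_fun setT (fun z : measurableTypeR R => z ^+ 2).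
    exact: measurable_funX.
  rewrite (integral_isonormal lawN msq); first exact: normal_second_moment_ge.
  by move=> z; exact: sqr_ge0.
rewrite (integral_isonormal lawN (mexc _) (exc0 _)).
apply: le_trans; last first.
  apply: (le_trans (integral_excess_normal p0 sd0 y2)).
  rewrite lee_fin sqr_sqrtr ?mulr_ge0//.
  have -> : 2 * y / 2 = y by field.
  rewrite -mulrA ler_wpM2l ?(ltW (gauss_cst_gt0 p))// mulrC.
  rewrite ler_wpM2l ?expR_ge0//.
  by rewrite ge0_ler_powR ?nnegrE ?(ltW p0) ?(ltW sd0).
apply: ge0_le_integral => //.
- by apply/measurable_EFinP; exact: mexc.
- by apply/measurable_EFinP; exact: mexc.
move=> z _; rewrite lee_fin; apply: ge0_ler_powR.
- exact: ltW.
- by rewrite nnegrE le_max lexx.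
- by rewrite nnegrE le_max lexx.
rewrite ge_max; apply/andP; split; rewrite le_max ?lexx//.
by rewrite lerD2l lerN2 ler_wpM2l// orbT.
Qed.

Lemma isonormal_comb (c : R) t u :
  {ae P, forall w, L (c *: t + u) w = c * L t w + L u w}.
Proof. exact: isonormal_linear hL c t u. Qed.

Lemma isonormal0 : {ae P, forall w, L 0 w = 0}.
Proof.
apply: filterS (isonormal_comb 1 0 0) => w.
by rewrite scaler0 addr0 mul1r => /eqP; rewrite -subr_eq subrr eq_sym => /eqP.
Qed.

Lemma isonormalB t u : {ae P, forall w, L (t - u) w = L t w - L u w}.
Proof.
apply: filterS (isonormal_comb (-1) u t) => w.
by rewrite scaleN1r mulN1r addrC => ->; rewrite addrC.
Qed.

Lemma isonormal_sum (I : finType) (c : I -> R) (e : I -> H) :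
  {ae P, forall w, L (\sum_i c i *: e i) w = \sum_i c i * L (e i) w}.
Proof.
elim: (index_enum I) => [|i r IH].
  by apply: filterS isonormal0 => w; rewrite !big_nil.
apply: filterS2 IH (isonormal_comb (c i) (e i) (\sum_(j <- r) c j *: e j)) => w.
by rewrite !big_cons => <-.
Qed.

End isonormal.

(** * Linear functionals on a subspace, orthonormal bases and projections *)

Section linear_functional.
Context (R : realType) (V : lmodType R) (A : set V) (T : V -> R).
Hypotheses (hA : linear_subspace A) (hT : linear_functional_on A T).

Lemma subspace0 : A 0.
Proof. by case: hA => /set_mem. Qed.

Lemma subspace_comb (a : R) u v : A u -> A v -> A (a *: u + v).
Proof.
by move=> Au Av; case: hA => _ /(_ a u v (mem_set Au) (mem_set Av)) /set_mem.
Qed.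

Lemma subspace_sum (I : finType) (c : I -> R) (e : I -> V) :
  (forall i, A (e i)) -> A (\sum_i c i *: e i).
Proof.
move=> Ae; elim/big_rec: _ => [|i v _ Av]; first exact: subspace0.
exact: subspace_comb.
Qed.

Lemma linear_functional0 : T 0 = 0.
Proof.
have := hT 1 subspace0 subspace0; rewrite scaler0 addr0 mul1r => /eqP.
by rewrite -subr_eq subrr eq_sym => /eqP.
Qed.

Lemma linear_functional_sum (I : finType) (c : I -> R) (e : I -> V) :
  (forall i, A (e i)) -> T (\sum_i c i *: e i) = \sum_i c i * T (e i).
Proof.
move=> Ae; elim: (index_enum I) => [|i r IH].
  by rewrite !big_nil linear_functional0.
rewrite !big_cons -IH hT//.
elim/big_rec: _ => [|j v _ Av]; [exact: subspace0|exact: subspace_comb].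
Qed.

End linear_functional.

(* Restatements with [dot] itself as the head symbol instead of its bilinear
   coercion, so that they chain under rewriting. *)
Section dot_product.
Context (R : realType) (V : lmodType R) (dot : {dot V for idfun}).
Implicit Types u v w : V.

Lemma dotC u v : dot u v = dot v u.
Proof. by rewrite hermC expr0 mul1r. Qed.

Lemma dotBl u v w : dot (u - v) w = dot u w - dot v w.
Proof. exact: linearBl. Qed.

Lemma dotZl (a : R) u v : dot (a *: u) v = a * dot u v.
Proof. exact: linearZl_LR. Qed.

Lemma dotZr (a : R) u v : dot u (a *: v) = a * dot u v.
Proof. by rewrite dotC dotZl dotC. Qed.

Lemma dot_suml (I : finType) (f : I -> V) v :
  dot (\sum_i f i) v = \sum_i dot (f i) v.
Proof. exact: linear_sumlz. Qed.

Lemma dot_sumr (I : finType) (f : I -> V) u :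
  dot u (\sum_i f i) = \sum_i dot u (f i).
Proof. by rewrite dotC dot_suml; apply: eq_bigr => i _; rewrite dotC. Qed.

End dot_product.

Section orthonormal.
Context (R : realType) (V : lmodType R) (dot : {dot V for idfun}).
Context (A : set V) (I : finType) (e : I -> V).
Hypotheses (hA : linear_subspace A) (he : orthonormal_basis dot A e).

Lemma dot_sum_basis (c : I -> R) i : dot (\sum_j c j *: e j) (e i) = c i.
Proof.
rewrite dot_suml (bigD1 i)//= big1 => [|j ji].
  by rewrite dotZl (basis_orthonormal he) eqxx mulr1 addr0.
by rewrite dotZl (basis_orthonormal he) (negbTE ji) mulr0.
Qed.

Lemma dot_sum_sum (a b : I -> R) :
  dot (\sum_i a i *: e i) (\sum_i b i *: e i) = \sum_i a i * b i.
Proof.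
by rewrite dot_sumr; apply: eq_bigr => i _; rewrite dotZr dot_sum_basis mulrC.
Qed.

(** The sum lies in [A] and its residual is orthogonal to each basis vector. It is the only such
    element: the difference of two candidates lies in [A], hence is orthogonal to both residuals and
    so to itself. *)
Lemma orth_projE (v : V) : orth_proj dot A v = \sum_i dot v (e i) *: e i.
Proof.
have basisA := basis_mem he.
set w := \sum_i _; have Aw : A w by exact: subspace_sum.
have orth u : A u -> dot (v - w) u = 0.
  move=> /(basis_span he)[c ->]; rewrite dot_sumr big1// => i _.
  by rewrite dotZr dotBl dot_sum_basis subrr mulr0.
apply: xget_unique => // w' [Aw' orth'].
have Aww' : A (w - w').
  by rewrite addrC -scaleN1r; exact: subspace_comb.
apply/eqP; rewrite eq_sym -subr_eq0; apply/negP => /negP.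
move=> /(neq0_dnorm_gt0 (s := dot)).
have -> : dot (w - w') (w - w') = dot (v - w') (w - w') - dot (v - w) (w - w').
  by rewrite -dotBl opprB [v - w' + _]addrC addrA subrK.
by rewrite orth// orth'// subrr ltxx.
Qed.

End orthonormal.

(** * The selection rule, and powers of finite sums *)

Lemma nat_infimum_mem (A : set nat) : A !=set0 -> A (infimum 0%N A).
Proof.
move=> [a0 Aa0]; have exA : exists n, `[< A n >] by exists a0; apply/asboolP.
have [m /asboolP Am minm] := ex_minnP exA.
rewrite /infimum; case: ifPn => [/eqP A0|_]; first by move: Aa0; rewrite A0.
(* The least element provided by well-ordering is an infimum, and infima are unique; the default 0
   would be returned only for an empty set. *)
have infm : infimums A m.
  by split=> [n An|n /(_ _ Am)//]; apply: minm; apply/asboolP.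
by rewrite (xget_unique _ infm)// => y /(is_subset1_infimums infm).
Qed.

Section selection.
Context (R : realType).
Implicit Types (M : set nat) (D : nat -> nat -> R) (pen : nat -> R).

Lemma criterion_ge M D pen m j : M j -> (m <= j)%N ->
  ((D j m + pen m)%:E <= criterion M D pen m)%E.
Proof.
move=> Mj mj; rewrite /criterion EFinD leeD2r//.
by apply: ereal_sup_ubound; exists j.
Qed.

Lemma criterion_le M D pen m (c : R) :
  (forall j, M j -> (m <= j)%N -> D j m + pen m <= c) ->
  (criterion M D pen m <= c%:E)%E.
Proof.
move=> Dc; rewrite /criterion -[c](subrK (pen m)) EFinD leeD2r//.
apply: ge_ereal_sup => _ [j [Mj mj] <-].
by rewrite lee_fin lerBrDr; exact: Dc.
Qed.

Lemma eq_criterion M D D' pen m : (forall j, M j -> D j m = D' j m) ->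
  criterion M D pen m = criterion M D' pen m.
Proof.
move=> DD'; rewrite /criterion; congr (ereal_sup _ + _)%E.
by apply: eq_imagel => j [Mj _]; rewrite DD'.
Qed.

Lemma eq_selected M (f g : nat -> \bar R) n : (forall m, M m -> f m = g m) ->
  selected M f n = selected M g n.
Proof.
move=> fg; rewrite /selected (eq_imagel fg); congr (infimum 0%N _).
by apply/seteqP; split=> m [Mm]; [rewrite fg//|rewrite -fg//].
Qed.

(** Nonnegativity keeps the infimum of [crit] away from [-oo]. If it is finite, some index comes
    within [1/n] of it; if it is [+oo], every index qualifies. The selecting set is thus nonempty
    and contains its infimum. *)
Lemma selected_spec M (crit : nat -> \bar R) n : M !=set0 -> (1 <= n)%N ->
  (forall m, M m -> 0 <= crit m)%E ->
  M (selected M crit n) /\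
  (forall j, M j -> crit (selected M crit n) <= crit j + (n%:R^-1)%:E)%E.
Proof.
move=> [m0 Mm0] n1 crit0.
have n0 : 0 < n%:R^-1 :> R by rewrite invr_gt0 ltr0n.
suff /nat_infimum_mem[Ms le] : [set m | M m /\
    (crit m <= ereal_inf [set crit j | j in M] + (n%:R^-1)%:E)%E] !=set0.
  split => // j Mj; apply: (le_trans le); rewrite leeD2r//.
  by apply: ereal_inf_lbound; exists j.
have inf0 : (0 <= ereal_inf [set crit j | j in M])%E.
  by apply: le_ereal_inf_tmp => _ [j Mj <-]; exact: crit0.
have [infy|infNy] := eqVneq (ereal_inf [set crit j | j in M]) +oo%E.
  by exists m0; split; rewrite // infy leey.
have [|_ [j Mj <-] /ltW jle] := lb_ereal_inf_adherent n0
    (S := [set crit j | j in M]).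
  by rewrite ge0_fin_numE// ltey.
by exists j.
Qed.

Lemma powR_sum_le (p : R) (s : seq R) : 0 < p ->
  (forall a, a \in s -> 0 <= a) ->
  (\sum_(a <- s) a) `^ p <= (size s)%:R `^ p * \sum_(a <- s) a `^ p.
Proof.
move=> p0 s0.
have [b [b0 sb bp]] : exists b, [/\ 0 <= b, forall a, a \in s -> a <= b &
    b `^ p <= \sum_(a <- s) a `^ p].
  elim: s s0 => [_|a s IH s0].
    by exists 0; split=> //; rewrite big_nil powR0 ?gt_eqF.
  have [|b [b0 sb bp]] := IH; first by move=> y ys; rewrite s0// inE ys orbT.
  have [ab|ba] := leP a b.
    exists b; split=> //; last by rewrite big_cons ler_wpDl// powR_ge0.
    by move=> y; rewrite inE => /predU1P[->//|/sb].
  exists a; split; first exact: le_trans (ltW ba).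
    by move=> y; rewrite inE => /predU1P[->//|/sb /le_trans->//]; exact: ltW.
  rewrite big_cons ler_wpDr//.
  by apply: sumr_ge0 => y _; exact: powR_ge0.
apply: (@le_trans _ _ (((size s)%:R * b) `^ p)); last first.
  by rewrite powRM// ler_wpM2l ?powR_ge0.
have sumb : \sum_(a <- s) a <= (size s)%:R * b.
  apply: (@le_trans _ _ (\sum_(a <- s) b)).
    by rewrite big_seq [leRHS]big_seq ler_sum.
  by rewrite big_const_seq count_predT iter_addr_0 mulr_natl.
apply: ge0_ler_powR; rewrite ?nnegrE ?(ltW p0) ?mulr_ge0//.
by rewrite big_seq sumr_ge0.
Qed.

End selection.

(** * The deterministic oracle inequality *)

Section oracle.
Context (R : realType) (M : set nat) (n : nat) (t X : nat -> R) (ts : R)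
  (pen : nat -> R) (Hf : nat -> nat -> R) (p : R).
Hypotheses (hM : M !=set0) (hn : (1 <= n)%N) (p0 : 0 < p).
Hypothesis pen_ge0 : forall m, M m -> 0 <= pen m.
Hypothesis Hf_ge0 : forall j m, 0 <= Hf j m.
Hypothesis Hf_diag : forall m, Hf m m = 0.

Let crit := criterion M (fun j m => `|t j - t m|) pen.
Let crithat :=
  criterion M (fun j m => `|(t m + X m) - (t j + X j)| - Hf j m) pen.
Let ms := selected M crit n.
Let mh := selected M crithat n.

Lemma crit_ge0 m : M m -> (0 <= crit m)%E.
Proof.
move=> Mm; apply: le_trans (criterion_ge _ _ Mm (leqnn m)).
by rewrite lee_fin addr_ge0// pen_ge0.
Qed.

Lemma crithat_ge_pen m : M m -> ((pen m)%:E <= crithat m)%E.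
Proof.
move=> Mm; apply: le_trans (criterion_ge _ _ Mm (leqnn m)).
by rewrite subrr normr0 Hf_diag subr0 add0r.
Qed.

Lemma selected_hat_mem : M mh.
Proof.
have [] // := selected_spec hM hn
  (fun m Mm => le_trans (pen_ge0 Mm : (0 <= (pen m)%:E)%E) (crithat_ge_pen Mm)).
Qed.

Lemma oracle_ineq (c al be h : R) : crit ms = c%:E ->
  (forall j, M j -> (j <= ms)%N -> Hf ms j `^ p <= h) ->
  (forall j, M j -> (Num.max 0 (`|X j| - pen j)) `^ p <= al) ->
  (forall j, M j -> (ms <= j)%N ->
     (Num.max 0 (`|X j - X ms| - Hf j ms)) `^ p <= be) ->
  `|t mh + X mh - ts| `^ p <= 2 * 6 `^ p *
    (c `^ p + `|t ms - ts| `^ p + h + (n%:R `^ p)^-1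
     + `|X ms| `^ p + al + be).
Proof.
move=> msE hh hal hbe.
have [Mms _] := selected_spec hM hn crit_ge0.
have [Mmh mhP] := selected_spec hM hn
  (fun m Mm => le_trans (pen_ge0 Mm : (0 <= (pen m)%:E)%E) (crithat_ge_pen Mm)).
rewrite -/ms -/mh in Mms Mmh mhP.
have ni0 : 0 <= n%:R^-1 :> R by rewrite invr_ge0.
have niE : (n%:R^-1 : R) `^ p = (n%:R `^ p)^-1.
  by rewrite -[n%:R^-1]powR_inv1// -powRrM mulrC powRrM powR_inv1 ?powR_ge0.
have be0 : 0 <= be by apply: le_trans (hbe _ Mms (leqnn _)); exact: powR_ge0.
have al0 : 0 <= al by apply: le_trans (hal _ Mms); exact: powR_ge0.
have h0 : 0 <= h by apply: le_trans (hh _ Mms (leqnn _)); exact: powR_ge0.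
have c0 : 0 <= c by rewrite -lee_fin -msE crit_ge0.
(* Taking the root turns the bound on [p]-th powers into a bound on the deviations, uniform in
   [j]. *)
set b := be `^ p^-1; have b0 : 0 <= b := powR_ge0 _ _.
have bE : b `^ p = be by rewrite -powRrM mulVf ?gt_eqF// powRr1.
have dev j : M j -> (ms <= j)%N -> `|X j - X ms| - Hf j ms <= b.
  move=> Mj mj; apply: (@le_trans _ _ (Num.max 0 (`|X j - X ms| - Hf j ms))).
    by rewrite le_max lexx orbT.
  set e := Num.max _ _; have e0 : 0 <= e by rewrite le_max lexx.
  have -> : e = (e `^ p) `^ p^-1 by rewrite -powRrM mulfV ?gt_eqF// powRr1.
  apply: ge0_ler_powR; rewrite ?nnegrE ?powR_ge0 ?invr_ge0 ?(ltW p0)//.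
  exact: hbe.
have critms j : M j -> (ms <= j)%N -> `|t j - t ms| + pen ms <= c.
  by move=> Mj mj; rewrite -lee_fin -msE; exact: criterion_ge.
(* The penalty of [ms] is already counted in [c], so passing from [crit] to [crithat] costs only the
   noise term [b]. *)
have hat_ms : (crithat ms <= (c + b)%:E)%E.
  apply: criterion_le => j Mj mj.
  have := critms j Mj mj; have := dev j Mj mj.
  have : `|t ms + X ms - (t j + X j)| <= `|t j - t ms| + `|X j - X ms|.
    rewrite distrC; have -> : t j + X j - (t ms + X ms) =
      (t j - t ms) + (X j - X ms) by ring.
    exact: ler_normD.
  lra.
have hat_mh : (crithat mh <= (c + b + n%:R^-1)%:E)%E.
  by apply: le_trans (mhP _ Mms) _; rewrite EFinD leeD2r.
have K0 : 0 <= 6 `^ p :> R := powR_ge0 _ _.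
set e := `|t ms - ts|; have e0 : 0 <= e by exact: normr_ge0.
have eP := powR_ge0 e p; have cP := powR_ge0 c p.
have nP : 0 <= (n%:R `^ p)^-1 :> R by rewrite invr_ge0 powR_ge0.
have XP := powR_ge0 `|X ms| p.
have [mle|/ltnW mge] := leqP ms mh.
  have penmh : pen mh <= c + b + n%:R^-1.
    by rewrite -lee_fin; apply: le_trans hat_mh; exact: crithat_ge_pen.
  set a := Num.max 0 (`|X mh| - pen mh).
  have a0 : 0 <= a by rewrite le_max lexx.
  have aE : `|X mh| - pen mh <= a by rewrite le_max lexx orbT.
  have aP : a `^ p <= al by exact: hal.
  (* One [c] bounds [t mh - t ms]; the other comes from [penmh], since the noise at [mh] is at most
     [a + pen mh]. *)
  have le : `|t mh + X mh - ts| <=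
      \sum_(z <- [:: c; c; b; n%:R^-1; e; a]) z.
    rewrite !big_cons big_nil.
    have -> : t mh + X mh - ts = X mh + ((t mh - t ms) + (t ms - ts)) by ring.
    have := ler_normD (X mh) ((t mh - t ms) + (t ms - ts)).
    have := ler_normD (t mh - t ms) (t ms - ts).
    have := critms mh Mmh mle; have := pen_ge0 Mms.
    rewrite -/e; lra.
  have ge0 z : z \in [:: c; c; b; n%:R^-1; e; a] -> 0 <= z.
    by rewrite !inE => /or4P[|||/or3P[]] /eqP->.
  apply: (@le_trans _ _ (6 `^ p *
      \sum_(z <- [:: c; c; b; n%:R^-1; e; a]) z `^ p)).
    apply: le_trans (powR_sum_le p0 ge0).
    apply: ge0_ler_powR le; rewrite ?nnegrE ?(ltW p0)//.
    by rewrite big_seq sumr_ge0.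
  rewrite [2 * _]mulrC -mulrA ler_wpM2l//.
  rewrite !big_cons big_nil bE niE; lra.
have H0 := Hf_ge0 ms mh; have HP := hh mh Mmh mge.
(* Here [ms] is one of the indices in the supremum defining [crithat mh], and [pen mh] is dropped by
   nonnegativity. *)
have le : `|t mh + X mh - ts| <=
    \sum_(z <- [:: c; b; n%:R^-1; Hf ms mh; `|X ms|; e]) z.
  rewrite !big_cons big_nil.
  have : `|t mh + X mh - (t ms + X ms)| - Hf ms mh + pen mh <= c + b + n%:R^-1.
    by rewrite -lee_fin; apply: le_trans hat_mh; exact: criterion_ge.
  have -> : t mh + X mh - ts =
    (t mh + X mh - (t ms + X ms)) + (X ms + (t ms - ts)) by ring.
  have := ler_normD (t mh + X mh - (t ms + X ms)) (X ms + (t ms - ts)).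
  have := ler_normD (X ms) (t ms - ts).
  have := pen_ge0 Mmh.
  rewrite -/e; lra.
have ge0 z : z \in [:: c; b; n%:R^-1; Hf ms mh; `|X ms|; e] -> 0 <= z.
  by rewrite !inE => /or4P[|||/or3P[]] /eqP->.
apply: (@le_trans _ _ (6 `^ p *
    \sum_(z <- [:: c; b; n%:R^-1; Hf ms mh; `|X ms|; e]) z `^ p)).
  apply: le_trans (powR_sum_le p0 ge0).
  apply: ge0_ler_powR le; rewrite ?nnegrE ?(ltW p0)//.
  by rewrite big_seq sumr_ge0.
rewrite [2 * _]mulrC -mulrA ler_wpM2l//.
rewrite !big_cons big_nil bE niE; lra.
Qed.

End oracle.

(** * Integrals of countable nonnegative sums *)

Section integral_complements.
Local Open Scope ereal_scope.
Context d (T : measurableType d) (R : realType).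
Variable mu : {measure set T -> \bar R}.

(* The integral of a non-measurable [f] is a lower integral. *)
Lemma ge0_le_lower_integral (f g : T -> \bar R) :
  (forall x, 0 <= f x) -> (forall x, f x <= g x) ->
  \int[mu]_x f x <= \int[mu]_x g x.
Proof.
move=> f0 fg; rewrite !ge0_integralTE//; last first.
  by move=> x; exact: le_trans (fg x).
apply: ereal_sup_le => _ [h hf <-]; exists h => // x.
exact: le_trans (hf x) (fg x).
Qed.

(** Padding with zeros makes the sum a series over all naturals, to which measurability and monotone
    convergence results for series apply. *)
Lemma esum_nneseries (I : set nat) (a : nat -> \bar R) : (forall k, 0 <= a k) ->
  \esum_(k in I) a k = \sum_(k <oo) (if k \in I then a k else 0).
Proof.
by move=> a0; rewrite esum_mkcond nneseries_esumT// => k; case: (k \in I).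
Qed.

Lemma measurable_esum (I : set nat) (a : nat -> T -> \bar R) :
  (forall k, measurable_fun setT (a k)) -> (forall k x, 0 <= a k x) ->
  measurable_fun setT (fun x => \esum_(k in I) a k x).
Proof.
move=> ma a0; under eq_fun do rewrite esum_nneseries//.
apply: ge0_emeasurable_sum => [k x _ _|k _]; first by case: (k \in I).
by case: (k \in I).
Qed.

Lemma integral_esum (I : set nat) (a : nat -> T -> \bar R) :
  (forall k, measurable_fun setT (a k)) -> (forall k x, 0 <= a k x) ->
  \int[mu]_x (\esum_(k in I) a k x) = \esum_(k in I) (\int[mu]_x a k x).
Proof.
move=> ma a0; under eq_integral do rewrite esum_nneseries//.
rewrite esum_nneseries; last by move=> k; exact: integral_ge0.
rewrite integral_nneseries//; last 2 first.
- by move=> k; case: (k \in I).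
- by move=> k x _; case: (k \in I).
by apply: eq_eseriesr => k _; case: (k \in I) => //; exact: integral0.
Qed.

Lemma ge0_esumZl (I : set nat) (a : nat -> \bar R) (r : R) : (0 <= r)%R ->
  (forall k, 0 <= a k) ->
  \esum_(k in I) (r%:E * a k) = r%:E * \esum_(k in I) a k.
Proof.
move=> r0 a0; rewrite !esum_nneseries//; last by move=> k; rewrite mule_ge0.
rewrite -nneseriesZl; last by move=> k _; case: (k \in I).
by apply: eq_eseriesr => k _; case: (k \in I) => //; rewrite mule0.
Qed.

Lemma esum_ge_term (I : set nat) (a : nat -> \bar R) k :
  (forall k, 0 <= a k) -> I k -> a k <= \esum_(j in I) a j.
Proof.
move=> a0 Ik; apply: esum_ge; exists [set k]; last by rewrite fsbig_set1.
by split; [exact: finite_set1|move=> _ ->].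
Qed.

End integral_complements.

Lemma integral_affine_sum d (T : measurableType d) (R : realType)
    (P : probability T R) (k c : R) (f g h : T -> \bar R) :
  0 <= k -> 0 <= c ->
  measurable_fun setT f -> measurable_fun setT g -> measurable_fun setT h ->
  (forall w, 0 <= f w)%E -> (forall w, 0 <= g w)%E -> (forall w, 0 <= h w)%E ->
  (\int[P]_w (k%:E * (c%:E + f w + g w + h w)) =
   k%:E * (c%:E + \int[P]_w f w + \int[P]_w g w + \int[P]_w h w))%E.
Proof.
move=> k0 c0 mf mg mh f0 g0 h0.
have mc : measurable_fun setT (fun _ : T => c%:E) by exact: measurable_cst.
have mcf := emeasurable_funD mc mf; have mcfg := emeasurable_funD mcf mg.
have cf0 w : (0 <= c%:E + f w)%E by rewrite adde_ge0.
have cfg0 w : (0 <= c%:E + f w + g w)%E by rewrite adde_ge0.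
rewrite ge0_integralZl//; last 2 first.
- exact: emeasurable_funD mcfg mh.
- by move=> w _; rewrite adde_ge0.
rewrite ge0_integralD// ge0_integralD// ge0_integralD//.
by rewrite integral_cst//= probability_setT mule1.
Qed.

(** * Moment bounds for variables almost surely equal to [L t] *)

Section excess.
Context (d : measure_display) (Omega : measurableType d) (R : realType)
  (P : probability Omega R) (H : completeNormedModType R)
  (L : H -> {RV P >-> R}).
Hypothesis hL : isonormal_process L.

Lemma integral_ae_isonormal (t : H) (Z : Omega -> R) (f : R -> R) :
  measurable_fun setT Z -> measurable_fun setT f -> (forall z, 0 <= f z) ->
  {ae P, forall w, L t w = Z w} ->
  (\int[P]_w (f (Z w))%:E = \int[P]_w (f (L t w))%:E)%E.
Proof.
move=> mZ mf f0 LZ; apply: ge0_ae_eq_integral => //.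
- by apply/measurable_EFinP; exact: (measurableT_comp mf mZ).
- by apply/measurable_EFinP; exact: measurableT_comp.
- by move=> w _; rewrite lee_fin.
- by move=> w _; rewrite lee_fin.
- by apply: filterS LZ => w ->.
Qed.

Lemma ae_isonormal_excess (p : R) (t : H) (Z : Omega -> R) (y : R) :
  0 < p -> 0 <= y -> measurable_fun setT Z ->
  {ae P, forall w, L t w = Z w} ->
  (\int[P]_w ((Num.max 0 (`|Z w| - Num.sqrt (2 * y) * `|t|)) `^ p)%:E
   <= (gauss_cst p)%:E * (expR (- y) * `|t| `^ p)%:E)%E.
Proof.
move=> p0 y0 mZ LZ.
rewrite (integral_ae_isonormal mZ (measurable_excess p _) _ LZ); last first.
  by move=> z; exact: powR_ge0.
by rewrite -EFinM; exact: isonormal_excess.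
Qed.

(** The case [y = 0] of the excess bound: the threshold vanishes and [expR (- y)] is 1. *)
Lemma ae_isonormal_power (p : R) (t : H) (Z : Omega -> R) :
  0 < p -> measurable_fun setT Z -> {ae P, forall w, L t w = Z w} ->
  (\int[P]_w (`|Z w| `^ p)%:E <= (gauss_cst p)%:E * (`|t| `^ p)%:E)%E.
Proof.
move=> p0 mZ LZ; have := ae_isonormal_excess p0 (lexx 0) mZ LZ.
rewrite mulr0 sqrtr0 oppr0 expR0 mul1r; apply: le_trans.
rewrite le_eqVlt; apply/orP; left; apply/eqP; apply: eq_integral => w _.
by rewrite mul0r subr0; have /max_idPr -> : 0 <= `|Z w| by [].
Qed.

End excess.

(** * The noise of the estimators and the vectors that represent it *)

Section model.
Context (d : measure_display) (Omega : measurableType d) (R : realType)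
  (P : probability Omega R) (H : completeNormedModType R)
  (dot : {dot H for idfun}) (n : nat) (sigma : R) (L : H -> {RV P >-> R})
  (s : H) (calS : set H) (T : H -> R).
Hypotheses (hH : hilbert_norm dot) (hn : (1 <= n)%N) (hsigma : 0 < sigma)
  (hL : isonormal_process L) (hcalS : linear_subspace calS)
  (hT : linear_functional_on calS T).

(** The variable [X m] of the introduction when [e] is the basis of [S_m]; [direction e] below is
    the vector [tau m]. *)
Definition noise (I : finType) (e : I -> H) (w : Omega) : R :=
  sigma / Num.sqrt n%:R * \sum_i T (e i) * L (e i) w.

Definition direction (I : finType) (e : I -> H) : H :=
  \sum_i (sigma / Num.sqrt n%:R * T (e i)) *: e i.

Let scale := sigma / Num.sqrt n%:R.

Let scale_sqr : scale ^+ 2 = sigma ^+ 2 / n%:R.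
Proof. by rewrite /scale exprMn exprVn sqr_sqrtr. Qed.

Lemma measurable_noise (I : finType) (e : I -> H) :
  measurable_fun setT (noise e).
Proof.
apply: measurable_funM; first exact: measurable_cst.
apply: measurable_sum => i.
exact: measurable_funM.
Qed.

Lemma noise_ae (I : finType) (e : I -> H) :
  {ae P, forall w, L (direction e) w = noise e w}.
Proof.
apply: filterS (isonormal_sum hL (fun i => scale * T (e i)) e) => w ->.
by rewrite /noise mulr_sumr; apply: eq_bigr => i _; rewrite mulrA.
Qed.

Lemma noiseB_ae (I J : finType) (e : I -> H) (f : J -> H) :
  {ae P, forall w, L (direction e - direction f) w = noise e w - noise f w}.
Proof.
apply: filterS3 (isonormalB hL (direction e) (direction f)) (noise_ae e)
  (noise_ae f) => w.
by move=> -> -> ->.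
Qed.

Lemma sigma1E (A : set H) (I : finType) (e : I -> H) :
  orthonormal_basis dot A e -> sigma1 n sigma T e = `|direction e|.
Proof.
move=> he; rewrite -[RHS]ger0_norm// -sqrtr_sqr hH /direction.
rewrite (dot_sum_sum he) /sigma1 -scale_sqr mulr_sumr; congr Num.sqrt.
by apply: eq_bigr => i _; rewrite -/scale; ring.
Qed.

(** After scaling, the variable inside the expectation is almost surely
    [L (direction e - direction f)], whose second moment is given by the isometry. *)
Lemma sigma2E (I J : finType) (e : I -> H) (f : J -> H) :
  sigma2 n sigma T L f e = `|direction e - direction f|.
Proof.
rewrite /sigma2; set Q := 'E_P[_]%E.
have QE : ((scale ^+ 2)%:E * Q = (`|direction e - direction f| ^+ 2)%:E)%E.
  rewrite -(isonormal_sqr hL).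
  have msq : measurable_fun setT (fun z : R => z ^+ 2).
    exact: measurable_funX.
  have mZ : measurable_fun setT (fun w => noise e w - noise f w).
    by apply: measurable_funB; exact: measurable_noise.
  rewrite -(integral_ae_isonormal mZ msq _ (noiseB_ae e f)); last first.
    by move=> z; exact: sqr_ge0.
  rewrite /Q unlock -ge0_integralZl//; last 3 first.
  - apply/measurable_EFinP; apply: measurable_funX; apply: measurable_funB.
      by apply: measurable_sum => i; exact: measurable_funM.
    by apply: measurable_sum => i; exact: measurable_funM.
  - by move=> w _; rewrite lee_fin sqr_ge0.
  - by rewrite lee_fin sqr_ge0.
  by apply: eq_integral => w _; rewrite -EFinM -exprMn mulrBr.
(* An infinite [Q] would stay infinite after multiplication by the positive [scale ^+ 2], whereas
   [QE] gives a real value. Hence [fine] is harmless. *)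
have Qfin : Q \is a fin_num.
  have s0 : 0 < scale ^+ 2.
    by rewrite exprn_gt0// divr_gt0// sqrtr_gt0 ltr0n.
  have Q0 : (0 <= Q)%E by apply: expectation_ge0 => w; exact: sqr_ge0.
  rewrite ge0_fin_numE// ltey; apply/negP => /eqP Qy.
  by move: QE; rewrite Qy gt0_muley.
rewrite -[RHS]ger0_norm// -sqrtr_sqr; congr Num.sqrt.
by apply: EFin_inj; rewrite -QE EFinM fineK// scale_sqr.
Qed.

Lemma sigma2_diag (I : finType) (e : I -> H) : sigma2 n sigma T L e e = 0.
Proof. by rewrite sigma2E subrr normr0. Qed.

(** The coefficient of the estimator on [e i] splits into [dot s (e i)], which builds the projection
    of [s], and a multiple of [L (e i) w], which builds the noise. *)
Lemma T_estimator (A : set H) (I : finType) (e : I -> H) (w : Omega) :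
  linear_subspace A -> A `<=` calS -> orthonormal_basis dot A e ->
  T (projection_estimator (observation dot s n sigma L) e w) =
  T (orth_proj dot A s) + noise e w.
Proof.
move=> hA AS he; have eS i : calS (e i) by apply: AS; exact: (basis_mem he).
rewrite (orth_projE hA he) !(linear_functional_sum hcalS hT)//.
rewrite /noise mulr_sumr -big_split/=; apply: eq_bigr => i _.
by rewrite /observation; ring.
Qed.

End model.

(** All terms being different from [-oo], one infinite term makes the whole right-hand side [+oo];
    only real values remain to be treated. *)
Lemma ereal_rhs_cases (R : realType) (C a b v : R) (q x y z u : \bar R) :
  0 < C -> (0 <= x)%E -> (0 <= y)%E -> (0 <= z)%E -> (0 <= u)%E ->
  (forall x' y' z' u' : R, x = x'%:E -> y = y'%:E -> z = z'%:E -> u = u'%:E ->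
    (q <= (C * (x' + a + b) + C * (y' + z' + u' + v))%:E)%E) ->
  (q <= C%:E * (x + a%:E + b%:E) + C%:E * (y + z + u + v%:E))%E.
Proof.
move=> C0; case: x => [x| |]// x0; last first.
  case: y => [y| |]// y0; case: z => [z| |]// z0; case: u => [u| |]// u0 _;
  by rewrite ?(addye, addey, gt0_muley, leey).
case: y => [y| |]// y0; case: z => [z| |]// z0; case: u => [u| |]// u0 qP;
  rewrite ?(addye, addey, gt0_muley, leey)//.
exact: qP.
Qed.

(** * Integration of the oracle inequality *)

Theorem theorem1 (R : realType) (p : R) (hp : 1 <= p) :
  exists C : R, 0 < C /\
  forall (d : measure_display) (Omega : measurableType d)
    (P : probability Omega R)
    (H : completeNormedModType R) (dot : {dot H for idfun})
    (hH : hilbert_norm dot) (sepH : separable H)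
    (n : nat) (hn : (1 <= n)%N) (sigma : R) (hsigma : 0 < sigma)
    (L : H -> {RV P >-> R}) (hL : isonormal_process L)
    (s : H) (calS : set H) (T : H -> R)
    (hcalS : linear_subspace calS) (hT : linear_functional_on calS T)
    (M : set nat) (hM : M !=set0)
    (S : nat -> set H) (hS : forall m, M m -> linear_subspace (S m))
    (s_calS : calS s) (S_calS : forall m, M m -> S m `<=` calS)
    (Lambda : nat -> finType) (phi : forall m, Lambda m -> H)
    (hphi : forall m, M m -> orthonormal_basis dot (S m) (@phi m))
    (x : nat -> R) (hx : forall m, M m -> 0 <= x m)
    (x2 : nat -> nat -> R) (hx2 : forall j m, M j -> M m -> 0 <= x2 j m),
  let Y := observation dot s n sigma L in
  let sproj (m : nat) := orth_proj dot (S m) s in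
  let shat (m : nat) (w : Omega) := projection_estimator Y (@phi m) w in
  let sig (m : nat) := sigma1 n sigma T (@phi m) in
  let pen (m : nat) := Num.sqrt (2 * x m) * sig m in
  let sig2 (j m : nat) := sigma2 n sigma T L (@phi j) (@phi m) in
  let Hjm (j m : nat) := Num.sqrt (2 * x2 j m) * sig2 j m in
  let Crithat (w : Omega) :=
    criterion M (fun j m => `|T (shat m w) - T (shat j w)| - Hjm j m) pen in
  let mhat (w : Omega) := selected M (Crithat w) n in
  let Crit := criterion M (fun j m => `|T (sproj j) - T (sproj m)|) pen in
  let mstar := selected M Crit n in
  ('E_P[fun w => (`|T (shat (mhat w) w) - T s| `^ p)%R]
   <= C%:E * (Crit mstar `^ p
              + (`|T (sproj mstar) - T s| `^ p)%:E
              + (sig mstar `^ p)%:E)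
    + C%:E * (ereal_sup [set (Hjm mstar j `^ p)%:E |
                j in [set j | M j /\ (j <= mstar)%N]]
              + \esum_(m in M) (expR (- x m) * sig m `^ p)%:E
              + \esum_(j in [set j | M j /\ (mstar <= j)%N])
                  (expR (- x2 j mstar) * sig2 j mstar `^ p)%:E
              + ((n%:R `^ p)^-1)%:E))%E.
Proof.
have p0 : 0 < p by apply: lt_le_trans hp.
pose K : R := 2 * 6 `^ p; pose G := gauss_cst p.
have K0 : 0 < K by rewrite mulr_gt0 ?powR_gt0.
have G0 : 0 < G := gauss_cst_gt0 p.
(* [K] is the constant of [oracle_ineq]. The deterministic terms come with coefficient 1 and the
   Gaussian ones with [G]; [1 + G] dominates both. *)
exists (K * (1 + G)); split; first by rewrite mulr_gt0 ?addr_gt0.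
move=> d Omega P H dot hH sepH n hn sigma hsigma L hL s calS T hcalS hT M hM S
  hS s_calS S_calS Lambda phi hphi x hx x2 hx2.
pose sproj m := orth_proj dot (S m) s.
pose shat m w := projection_estimator (observation dot s n sigma L) (@phi m) w.
pose sig m := sigma1 n sigma T (@phi m).
pose pen m := Num.sqrt (2 * x m) * sig m.
pose sig2 j m := sigma2 n sigma T L (@phi j) (@phi m).
pose Hjm j m := Num.sqrt (2 * x2 j m) * sig2 j m.
pose Crithat w :=
  criterion M (fun j m => `|T (shat m w) - T (shat j w)| - Hjm j m) pen.
pose mhat w := selected M (Crithat w) n.
pose Crit := criterion M (fun j m => `|T (sproj j) - T (sproj m)|) pen.
pose mstar := selected M Crit n.
change (('E_P[fun w => (`|T (shat (mhat w) w) - T s| `^ p)%R]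
   <= (K * (1 + G))%:E * (Crit mstar `^ p
              + (`|T (sproj mstar) - T s| `^ p)%:E
              + (sig mstar `^ p)%:E)
    + (K * (1 + G))%:E * (ereal_sup [set (Hjm mstar j `^ p)%:E |
                j in [set j | M j /\ (j <= mstar)%N]]
              + \esum_(m in M) (expR (- x m) * sig m `^ p)%:E
              + \esum_(j in [set j | M j /\ (mstar <= j)%N])
                  (expR (- x2 j mstar) * sig2 j mstar `^ p)%:E
              + ((n%:R `^ p)^-1)%:E))%E).
pose X m := noise n sigma L T (@phi m).
pose tau m := direction n sigma T (@phi m).
pose A m w := (Num.max 0 (`|X m w| - pen m)) `^ p.
pose B m w := (Num.max 0 (`|X m w - X mstar w| - Hjm m mstar)) `^ p.
have sig_ge0 m : 0 <= sig m by exact: sqrtr_ge0.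
have pen_ge0 m : M m -> 0 <= pen m by move=> _; rewrite mulr_ge0 ?sqrtr_ge0.
have Hjm_ge0 j m : 0 <= Hjm j m by rewrite mulr_ge0 ?sqrtr_ge0.
have Hjm_diag m : Hjm m m = 0 by rewrite /Hjm /sig2 sigma2_diag ?mulr0.
have sigE m : M m -> sig m = `|tau m|.
  by move=> Mm; exact: sigma1E (hphi m Mm).
have sig2E j m : sig2 j m = `|tau m - tau j| by exact: sigma2E.
have [Mms _] := selected_spec hM hn
  (crit_ge0 (fun m => T (sproj m)) pen_ge0).
rewrite -/Crit -/mstar in Mms.
have mX m : measurable_fun setT (X m) by exact: measurable_noise.
have mA m : measurable_fun setT (fun w => (A m w)%:E).
  apply/measurable_EFinP.
  exact: (measurableT_comp (measurable_excess p (pen m)) (mX m)).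
have mB m : measurable_fun setT (fun w => (B m w)%:E).
  apply/measurable_EFinP.
  apply: (measurableT_comp (measurable_excess p (Hjm m mstar))).
  exact: measurable_funB.
have A0 m w : (0 <= (A m w)%:E)%E by rewrite lee_fin powR_ge0.
have B0 m w : (0 <= (B m w)%:E)%E by rewrite lee_fin powR_ge0.
have intA m : M m ->
    (\int[P]_w (A m w)%:E <= G%:E * (expR (- x m) * sig m `^ p)%:E)%E.
  move=> Mm; rewrite /A /pen sigE//.
  apply: (ae_isonormal_excess hL p0 (hx m Mm) (mX m)).
  exact: noise_ae.
have intB m : M m -> (mstar <= m)%N ->
    (\int[P]_w (B m w)%:E
     <= G%:E * (expR (- x2 m mstar) * sig2 m mstar `^ p)%:E)%E.
  move=> Mm mm; rewrite /B /Hjm sig2E distrC.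
  apply: (ae_isonormal_excess hL p0 (hx2 m mstar Mm Mms)).
    exact: measurable_funB.
  exact: noiseB_ae.
have intX : (\int[P]_w (`|X mstar w| `^ p)%:E <= G%:E * (sig mstar `^ p)%:E)%E.
  rewrite sigE//; apply: (ae_isonormal_power hL p0 (mX mstar)).
  exact: noise_ae.
have supH0 : (0 <= ereal_sup [set (Hjm mstar j `^ p)%:E |
    j in [set j | M j /\ (j <= mstar)%N]])%E.
  apply: (@le_trans _ _ (Hjm mstar mstar `^ p)%:E).
    by rewrite lee_fin powR_ge0.
  by apply: ereal_sup_ubound; exists mstar.
apply: ereal_rhs_cases; rewrite ?mulr_gt0 ?addr_gt0//.
- exact: poweR_ge0.
- by apply: esum_ge0 => m _; rewrite lee_fin mulr_ge0 ?expR_ge0 ?powR_ge0.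
- by apply: esum_ge0 => m _; rewrite lee_fin mulr_ge0 ?expR_ge0 ?powR_ge0.
move=> cp h b2 b3 critE hE b2E b3E.
have Crit0 : (0 <= Crit mstar)%E by exact: crit_ge0.
(* An infinite criterion would have an infinite [p]-th power, since [p] is positive. *)
have [c critc] : exists c, Crit mstar = c%:E.
  case: (Crit mstar) Crit0 critE => [c| |]//; first by exists c.
  by rewrite poweRyr ?gt_eqF.
have cpE : c `^ p = cp by apply: EFin_inj; rewrite -critE critc.
set e := `|T (sproj mstar) - T s| `^ p.
set ni := (n%:R `^ p)^-1.
have ni0 : 0 <= ni by rewrite invr_ge0 powR_ge0.
pose D := c `^ p + e + h + ni.
have h0 : 0 <= h by rewrite -lee_fin -hE.
have e0 : 0 <= e by exact: powR_ge0.
have c0 : 0 <= c `^ p by exact: powR_ge0.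
have D0 : 0 <= D by rewrite !addr_ge0.
(* For fixed [w] the oracle inequality applies with the two series as [al] and [be], each series
   dominating every one of its terms. If a series diverges at [w], the bound is trivial. *)
have pointwise w : ((`|T (shat (mhat w) w) - T s| `^ p)%:E <=
    K%:E * (D%:E + (`|X mstar w| `^ p)%:E + \esum_(m in M) (A m w)%:E
      + \esum_(j in [set j | M j /\ (mstar <= j)%N]) (B j w)%:E))%E.
  have TE m : M m -> T (shat m w) = T (sproj m) + X m w.
    move=> Mm; have AS := S_calS m Mm.
    exact: (T_estimator n sigma L s hcalS hT w (hS m Mm) AS (hphi m Mm)).
  have mhatE : mhat w = selected M (criterion M (fun j m =>
      `|(T (sproj m) + X m w) - (T (sproj j) + X j w)| - Hjm j m) pen) n.
    apply: eq_selected => m Mm; apply: eq_criterion => j Mj.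
    by rewrite !TE.
  have Mmh : M (mhat w) by rewrite mhatE; exact: selected_hat_mem.
  have SA0 : (0 <= \esum_(m in M) (A m w)%:E)%E by apply: esum_ge0.
  have SB0 : (0 <= \esum_(j in [set j | M j /\ (mstar <= j)%N]) (B j w)%:E)%E.
    by apply: esum_ge0.
  have hal m : M m -> ((A m w)%:E <= \esum_(m in M) (A m w)%:E)%E.
    by move=> Mm; exact: (esum_ge_term (a := fun m => (A m w)%:E)).
  have hbe m : M m -> (mstar <= m)%N -> ((B m w)%:E <=
      \esum_(j in [set j | M j /\ (mstar <= j)%N]) (B j w)%:E)%E.
    by move=> Mm mm; apply: (esum_ge_term (a := fun m => (B m w)%:E)).
  move: SA0 SB0 hal hbe.
  move: (\esum_(m in M) (A m w)%:E)%E => SA.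
  move: (\esum_(j in [set j | M j /\ (mstar <= j)%N]) (B j w)%:E)%E => SB.
  case: SA SB => [al| |] [be| |]// _ _ hal hbe;
    rewrite ?(addye, addey, gt0_muley, leey)//.
  rewrite -!EFinD -EFinM lee_fin TE//.
  have := oracle_ineq (t := fun m => T (sproj m)) (X := X ^~ w) (T s) hM hn p0
    pen_ge0 Hjm_ge0 Hjm_diag (c := c) (al := al) (be := be) (h := h) critc.
  rewrite -mhatE; apply.
  - move=> j Mj jm; rewrite -lee_fin -hE; apply: ereal_sup_ubound.
    by exists j.
  - by move=> j Mj; rewrite -lee_fin; exact: hal.
  - by move=> j Mj mj; rewrite -lee_fin; exact: hbe.
have mSA : measurable_fun setT (fun w => \esum_(m in M) (A m w)%:E)%E.
  exact: (measurable_esum _ mA).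
have mSB : measurable_fun setT
    (fun w => \esum_(j in [set j | M j /\ (mstar <= j)%N]) (B j w)%:E)%E.
  exact: (measurable_esum _ mB).
have mXp : measurable_fun setT (fun w => (`|X mstar w| `^ p)%:E).
  apply/measurable_EFinP; apply: (measurableT_comp (measurable_powR p)).
  exact: measurableT_comp.
have SA0 w : (0 <= \esum_(m in M) (A m w)%:E)%E by apply: esum_ge0.
have SB0 w :
    (0 <= \esum_(j in [set j | M j /\ (mstar <= j)%N]) (B j w)%:E)%E.
  by apply: esum_ge0.
have Xp0 w : (0 <= (`|X mstar w| `^ p)%:E)%E by rewrite lee_fin powR_ge0.
(* Measurability of the error at the random index [mhat] is not established: the comparison is made
   on lower integrals, and only the majorant is measurable. *)
rewrite unlock; apply: (le_trans (ge0_le_lower_integral P _ pointwise)).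
  by move=> w; rewrite lee_fin powR_ge0.
rewrite (integral_affine_sum P (ltW K0) D0 mXp mSA mSB Xp0 SA0 SB0).
rewrite (integral_esum P M mA A0) (integral_esum P _ mB B0).
have sumA : (\esum_(m in M) (\int[P]_w (A m w)%:E) <= (G * b2)%:E)%E.
  rewrite EFinM -b2E -ge0_esumZl ?(ltW G0)//; last first.
    by move=> m; rewrite lee_fin mulr_ge0 ?expR_ge0 ?powR_ge0.
  by apply: le_esum => m Mm; exact: intA.
have sumB : (\esum_(m in [set j | M j /\ (mstar <= j)%N])
    (\int[P]_w (B m w)%:E)
    <= (G * b3)%:E)%E.
  rewrite EFinM -b3E -ge0_esumZl ?(ltW G0)//; last first.
    by move=> m; rewrite lee_fin mulr_ge0 ?expR_ge0 ?powR_ge0.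
  by apply: le_esum => m [Mm mm]; exact: intB.
apply: (@le_trans _ _ (K%:E *
    (D + G * sig mstar `^ p + G * b2 + G * b3)%:E)%E).
  by rewrite lee_wpmul2l ?lee_fin ?(ltW K0)// !EFinD !leeD.
rewrite -EFinM lee_fin -cpE.
have b20 : 0 <= b2.
  rewrite -lee_fin -b2E; apply: esum_ge0 => m _.
  by rewrite lee_fin mulr_ge0 ?expR_ge0 ?powR_ge0.
have b30 : 0 <= b3.
  rewrite -lee_fin -b3E; apply: esum_ge0 => m _.
  by rewrite lee_fin mulr_ge0 ?expR_ge0 ?powR_ge0.
rewrite -!(mulrA K) -mulrDr ler_wpM2l ?(ltW K0)// /D.
have sp0 := powR_ge0 (sig mstar) p.
have GP z : 0 <= z -> 0 <= G * z by move=> z0; rewrite mulr_ge0// ltW.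
have := (GP _ c0, GP _ e0, GP _ h0, GP _ ni0); move=> [[[g1 g2] g3] g4].
lra.
Qed.
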